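(* Let $q$ be a prime power and $E\subseteq\mathbb{F}_q^2$. Suppose that $|E|\,|\mathrm{Dir}(E)|>q^2$. Then there exists $e\in E$ such that $|E\cdot e|>q/2$.
   Context: For $E\subseteq\mathbb{F}_q^2$, the direction set $\mathrm{Dir}(E)\subseteq\mathbb{F}_q$ is the set of $\theta\in\mathbb{F}_q$ such that $(\lambda,\lambda\theta)\in E$ for some $\lambda\in\mathbb{F}_q\setminus\{0\}$. For $e\in\mathbb{F}_q^2$, $E\cdot e=\{u\cdot e: u\in E\}$ with $u\cdot e=u_1e_1+u_2e_2$. *)

(* Defs.v *)
From mathcomp Require Import all_boot all_order all_algebra.

Set Implicit Arguments.
Unset Strict Implicit.
Unset Printing Implicit Defensive.

Import GRing.Theory.
Local Open Scope ring_scope.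

Definition Dir (F : finFieldType) (E : {set F * F}) : {set F} :=
  [set theta | [exists lambda, (lambda != 0) && ((lambda, lambda * theta) \in E)]].

Definition dot (F : finFieldType) (u e : F * F) : F :=
  u.1 * e.1 + u.2 * e.2.

Definition dotset (F : finFieldType) (E : {set F * F}) (e : F * F) : {set F} :=
  [set dot u e | u in E].

(* Main.v *)
(** The fibres of the projection u |-> u.1 + theta * u.2 partition E, so by
   Cauchy-Schwarz the number N(theta) of pairs in E x E with equal projection
   satisfies |E|^2 <= |E.(1, theta)| N(theta); in particular
   |E|^2 <= q N(theta) for every theta.  Two distinct points collide for at most
   one theta, so the sum of N(theta) over F is at most q|E| + |E|^2.  If all
   |E.e| with e in E were at most q/2, then 2|E|^2 <= q N(theta) would hold for
   theta in Dir E, and summing over all theta would give |E||Dir E| <= q^2. *)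
Require Import Defs.
From mathcomp Require Import all_boot all_order all_algebra.

Set Implicit Arguments.
Unset Strict Implicit.
Unset Printing Implicit Defensive.

Import Order.TTheory GRing.Theory Num.Theory.

Section Collisions.

Variables (T S : finType).
Implicit Types (A : {set T}) (f : T -> S).

Definition collisions f A : nat := \sum_(u in A) \sum_(v in A) (f u == f v).

Lemma sum_fibres f A : \sum_(y in f @: A) \sum_(u in A) (f u == y) = #|A|.
Proof.
rewrite exchange_big /= -sum1_card; apply: eq_bigr => u Au.
rewrite (bigD1 (f u)) ?imset_f //= eqxx big1 // => y /andP[_ /negPf].
by rewrite eq_sym => ->.
Qed.

(** The square of a fibre's size counts the ordered pairs inside it, and a colliding pair lies in
    exactly one fibre, the one over [f u]. *)
Lemma sum_fibres_sqr f A :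
  \sum_(y in f @: A) (\sum_(u in A) (f u == y)) ^ 2 = collisions f A.
Proof.
under eq_bigr => y _ do rewrite -mulnn big_distrl.
rewrite exchange_big /=; apply: eq_bigr => u Au.
rewrite (bigD1 (f u)) ?imset_f //= eqxx mul1n [X in _ + X]big1 ?addn0.
  by apply: eq_bigr => v _; rewrite eq_sym.
by move=> y /andP[_ /negPf]; rewrite eq_sym => ->.
Qed.

(** Cauchy-Schwarz against the constant 1: after doubling, expand both sides over pairs and compare
    termwise by [2 * (a * b) <= a ^ 2 + b ^ 2]. *)
Lemma sqr_sum_leq (I : finType) (B : {set I}) (n : I -> nat) :
  (\sum_(i in B) n i) ^ 2 <= #|B| * \sum_(i in B) n i ^ 2.
Proof.
rewrite -(leq_pmul2l (ltn0Sn 1)) -[_ ^ 2]mulnn big_distrlr /=.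
have -> : 2 * (#|B| * \sum_(i in B) n i ^ 2)
    = \sum_(i in B) \sum_(j in B) (n i ^ 2 + n j ^ 2).
  under [RHS]eq_bigr => i _ do rewrite big_split /= sum_nat_const.
  by rewrite big_split /= sum_nat_const -big_distrr mul2n addnn.
rewrite big_distrr leq_sum // => i _; rewrite big_distrr leq_sum // => j _.
exact: nat_Cauchy.
Qed.

Lemma card_sqr_leq_collisions f A : #|A| ^ 2 <= #|f @: A| * collisions f A.
Proof.
by rewrite -{1}(sum_fibres f A) -sum_fibres_sqr; apply: sqr_sum_leq.
Qed.

End Collisions.

Section Projections.

Variable F : finFieldType.
Implicit Types (E : {set F * F}) (theta lambda : F).

Definition proj theta (u : F * F) : F := dot u (1, theta)%R.

Lemma dot_scale theta lambda u :
  dot u (lambda, lambda * theta)%R = (lambda * proj theta u)%R.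
Proof. by rewrite /proj /dot /= mulr1 mulrDr ![(u.1 * _)%R]mulrC mulrCA. Qed.

(** Multiplication by [lambda] is injective, so only the direction of a point matters; a bound at a
    point of [E] becomes a bound on a projection. *)
Lemma card_dotset_scale E theta lambda : lambda != 0%R ->
  #|dotset E (lambda, lambda * theta)%R| = #|proj theta @: E|.
Proof.
move=> nz_lambda.
rewrite -[RHS](card_imset _ (mulfI nz_lambda)) -imset_comp.
congr #|pred_of_set _|.
by apply: eq_imset => u; apply: dot_scale.
Qed.

Lemma proj_collision_uniq (u v : F * F) : u != v ->
  \sum_theta (proj theta u == proj theta v) <= 1.
Proof.
move=> neq_uv.
have -> : \sum_theta (proj theta u == proj theta v)
    = #|[pred theta | proj theta u == proj theta v]|.
  rewrite -sum1_card [RHS]big_mkcond; apply: eq_bigr => t _; rewrite inE.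
  by case: (_ == _).
apply/card_le1_eqP => s t /eqP eq_s /eqP eq_t; apply/eqP; apply: contraR neq_uv.
rewrite /proj /dot /= !mulr1 in eq_s eq_t; rewrite -subr_eq0 => nz_st.
(* Subtracting the collision equations at [s] and [t] eliminates the first coordinates and leaves a
   nonzero factor to cancel. *)
have eq2 : u.2 = v.2.
  apply: (mulIf nz_st); rewrite !mulrBr.
  have := congr2 (fun a b => a - b)%R eq_t eq_s.
  by rewrite !opprD !(addrACA _ _ (- _)%R) !subrr !add0r.
by apply/eqP/injective_projections => //; move: eq_s; rewrite eq2 => /addIr.
Qed.

Lemma sum_collisions_leq E :
  \sum_theta collisions (proj theta) E <= #|F| * #|E| + #|E| ^ 2.
Proof.
rewrite exchange_big /= -mulnn.
apply: (@leq_trans (\sum_(u in E) (#|F| + #|E|))).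
  apply: leq_sum => u Eu; rewrite exchange_big /= (bigD1 u) //= leq_add //.
    by under eq_bigr => theta _ do rewrite eqxx; rewrite sum1_card.
  (* The unit that [u] itself contributes to [#|E|] is given away against 0. *)
  rewrite -[X in _ <= X]sum1_card [X in _ <= X](bigD1 u) //= -[X in X <= _]add0n.
  rewrite leq_add // leq_sum // => v /andP[_ neq_vu].
  by apply: proj_collision_uniq; rewrite eq_sym.
by rewrite sum_nat_const mulnDr [#|F| * _]mulnC.
Qed.

End Projections.

Theorem theorem4 (F : finFieldType) (E : {set F * F}) :
  (#|F| ^ 2 < #|E| * #|Dir E|)%N ->
  exists e : F * F,
    e \in E /\ (#|F|%:R / 2%:R < #|dotset E e|%:R :> rat)%R.
Proof.
move=> ltE.
suff [e Ee lt_e] : exists2 e, e \in E & #|F| < #|dotset E e| * 2.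
  by exists e; split=> //; rewrite ltr_pdivrMr ?ltr0n // -natrM ltr_nat.
apply/exists_inP; apply: contraLR ltE => /exists_inPn small; rewrite -leqNgt.
have [->|E_gt0] := posnP #|E|; first by rewrite mul0n.
(* The boolean, read as 0 or 1, doubles the left side exactly when [theta] is a direction, so both
   cases can be summed at once. *)
have N_theta theta :
    #|E| ^ 2 + (theta \in Dir E) * #|E| ^ 2 <= #|F| * collisions (proj theta) E.
  have CS := card_sqr_leq_collisions (proj theta) E.
  case: (boolP (theta \in Dir E)) => [|_]; last first.
    by rewrite addn0 (leq_trans CS) // leq_mul2r max_card orbT.
  rewrite inE => /existsP[lambda /andP[nz_lambda Ee]].
  have := small _ Ee; rewrite -leqNgt card_dotset_scale // => le_half.
  rewrite mul1n addnn -mul2n (leq_trans (leq_mul (leqnn 2) CS)) // mulnA.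
  by rewrite leq_mul2r [2 * _]mulnC le_half orbT.
have sum_N : #|F| * #|E| ^ 2 + #|Dir E| * #|E| ^ 2
    <= #|F| * (#|F| * #|E| + #|E| ^ 2).
  rewrite (leq_trans _ (leq_mul (leqnn _) (sum_collisions_leq E))) //.
  rewrite big_distrr -[#|F| * #|E| ^ 2]sum_nat_const.
  rewrite -[#|Dir E| * _]sum_nat_const.
  rewrite [X in _ + X <= _]big_mkcond -big_split /=.
  apply: leq_sum => theta _.
  by apply: leq_trans (N_theta theta); case: ifP; rewrite ?mul1n.
(* The term [#|F| * #|E| ^ 2] cancels on both sides; then one factor [#|E|], positive by [E_gt0], is
   divided out. *)
rewrite mulnDr addnC leq_add2r mulnA !mulnn -[#|E| ^ 2]mulnn mulnA in sum_N.
by rewrite leq_pmul2r // mulnC in sum_N.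
Qed.
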